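(* Build permutations of $[n]=\{1,\dots,n\}$ by inserting the elements $1,2,\dots,n$ in order, where element $i+1$ either - opens a new cycle as a fixed point, or - is inserted immediately after one of the existing elements $1,\dots,i$ in cycle notation, except that when $i$ is odd, insertion immediately after the largest element $i$ is forbidden. Then distinct insertion histories produce distinct permutations, and $\mathsf c_2(n,k)$ counts the resulting permutations with exactly $k$ cycles. Equivalently, $\mathsf c_2(n,k)$ is the number of permutations $\pi$ of $[n]$ with $k$ cycles such that for every even $e\le n$ (with $e\geq 2$), the restriction of $\pi$ to $\{1,\dots,e\}$ (obtained by deleting the elements larger than $e$ from the cycle notation) does not map $e-1$ to $e$.
   Context: The unsigned Bessel--Stirling numbers of the first kind $\mathsf c_2(n,k)$ are defined for $n,k\ge0$ by $\mathsf c_2(0,k)=\delta_{0,k}$, the convention $\mathsf c_2(n,k)=0$ for $k<0$, and $\mathsf c_2(n+1,k)=2\lfloor n/2\rfloor\,\mathsf c_2(n,k)+\mathsf c_2(n,k-1)$. *)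

(* Defs.v *)
From HB Require Import structures.
From mathcomp Require Import all_boot fingroup perm.

Set Implicit Arguments.
Unset Strict Implicit.
Unset Printing Implicit Defensive.

(* The [else 0] branch is the convention c_2(n, -1) = 0. *)
Fixpoint c2 (n k : nat) : nat :=
  if n is m.+1
  then 2 * m./2 * c2 m k + (if k is k'.+1 then c2 m k' else 0)
  else k == 0.

(* Permutations of [n] = {1, ..., n} are elements of 'S_n; the ordinal i
   stands for the element i + 1 of [n]. *)
Definition label n (i : 'I_n) : nat := i.+1.

(* Insertion of the element n + 1 (which is ord_max : 'I_n.+1) in the cycle
   notation of s : as a new fixed point (None), or immediately after j
   (Some j).  Products of permutations act from left to right, so in the second
   case j is sent to n + 1 and n + 1 to s j; see the lemmas below. *)
Definition insert n (s : 'S_n) (c : option 'I_n) : 'S_n.+1 :=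
  let fixed := lift_perm ord_max ord_max s in
  if c is Some j then (tperm (lift ord_max j) ord_max * fixed)%g else fixed.

Lemma insert_open n (s : 'S_n) : insert s None ord_max = ord_max.
Proof. exact: lift_perm_id. Qed.

Lemma insert_open_old n (s : 'S_n) (i : 'I_n) :
  insert s None (lift ord_max i) = lift ord_max (s i).
Proof. exact: lift_perm_lift. Qed.

Lemma insert_after_pred n (s : 'S_n) (j : 'I_n) :
  insert s (Some j) (lift ord_max j) = ord_max.
Proof. by rewrite permM tpermL lift_perm_id. Qed.

Lemma insert_after_new n (s : 'S_n) (j : 'I_n) :
  insert s (Some j) ord_max = lift ord_max (s j).
Proof. by rewrite permM tpermR lift_perm_lift. Qed.

Lemma insert_after_old n (s : 'S_n) (i j : 'I_n) : i != j ->
  insert s (Some j) (lift ord_max i) = lift ord_max (s i).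
Proof.
move=> neq_ij; rewrite permM tpermD ?lift_perm_lift ?neq_lift //.
by rewrite (inj_eq lift_inj) eq_sym.
Qed.

(* With i elements present, insertion after the largest one is forbidden when
   i is odd. *)
Definition allowed i (c : option 'I_i) : bool :=
  if c is Some j then ~~ (odd i && (label j == i)) else true.

Fixpoint history (n : nat) : finType :=
  if n is i.+1
  then (history i * {c : option 'I_i | allowed c})%type
  else unit.

Fixpoint build (n : nat) : history n -> 'S_n :=
  if n is i.+1 return history n -> 'S_n
  then fun h => insert (build h.1) (val h.2)
  else fun=> 1%g.

(* Fixed points count as cycles: porbits contains the singleton orbits. *)
Definition ncycles n (s : 'S_n) : nat := #|porbits s|.

(* The restriction of s to {1, ..., e}: the image of x (with label x <= e) is
   its cyclic successor once the elements larger than e have been deleted from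
   the cycle (x, s x, s (s x), ...) of s.  The value is irrelevant when
   label x > e. *)
Definition restriction n (e : nat) (s : 'S_n) (x : 'I_n) : 'I_n :=
  next [seq y <- orbit s x | label y <= e] x.

Definition avoiding n (s : 'S_n) : bool :=
  [forall e : 'I_n.+1, (2 <= e) && ~~ odd e ==>
    [forall x : 'I_n, forall y : 'I_n,
      (label x == e - 1) && (label y == e) ==> (restriction e s x != y)]].

(* Main.v *)
Require Import Defs.
From HB Require Import structures.
From mathcomp Require Import all_boot fingroup perm.

(** Inserting the element n + 1 is a bijection from pairs (permutation of [n],
    place of insertion) to permutations of [n + 1]: the place of insertion is
    the predecessor of n + 1, and deleting n + 1 from the cycle notation
    recovers the old permutation ([insert_inj], [insert_surj]).  Injectivity of
    [build] follows by induction.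

    Deleting n + 1 from the cycle notation of [insert s c] gives that of [s]
    ([orbit_insert]), so the restrictions of [insert s c] and of [s] to
    {1, ..., e} agree for e <= n ([restriction_insert]).  The only new
    condition that avoidance puts on [insert s c] concerns e = n + 1; there
    nothing is deleted, and it says that for odd n the predecessor of n + 1
    must not be n, which is exactly [allowed c].  Hence [insert s c] avoids
    if and only if [s] avoids and [c] is allowed ([avoiding_insert]), and the
    permutations that are built are the avoiding ones ([avoiding_build]).

    Finally an insertion creates a cycle exactly when it opens one
    ([ncycles_insert]), and 2 * floor(n / 2) of the insertions after an existing
    element are allowed ([sum_allowed]).  Summing over all insertions yields
    the recursion that defines [c2] ([c2_avoiding]). *)

Set Implicit Arguments.
Unset Strict Implicit.
Unset Printing Implicit Defensive.

(** * Insertion as a bijection *)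

Lemma insert_eq_max n (s : 'S_n) (c : option 'I_n) (j : 'I_n) :
  (insert s c (lift ord_max j) == ord_max) = (c == Some j).
Proof.
case: c => [i|]; last by rewrite insert_open_old eq_sym (negPf (neq_lift _ _)).
rewrite -[X in _ == X](insert_after_pred s i) (inj_eq perm_inj) (inj_eq lift_inj).
by rewrite (inj_eq Some_inj) eq_sym.
Qed.

(** The place of insertion is read off as the predecessor of [ord_max]; undoing
    the insertion there leaves the old permutation with a new fixed point. *)
Lemma insert_inj n :
  injective (fun p : 'S_n * option 'I_n => insert p.1 p.2).
Proof.
move=> [s c] [s' c'] /= eq_ins.
have eq_c : c = c'.
  have eq_pred j : (c == Some j) = (c' == Some j).
    by rewrite -(insert_eq_max s) eq_ins insert_eq_max.
  case: c c' eq_pred {eq_ins} => [j|] [j'|] // eq_pred.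
  - by apply/eqP; rewrite eq_sym -eq_pred.
  - by have := eq_pred j; rewrite eqxx.
  - by have := eq_pred j'; rewrite eqxx.
rewrite -{c'}eq_c in eq_ins *; congr (_, _); apply/permP=> i.
have eq_fixed : lift_perm ord_max ord_max s = lift_perm ord_max ord_max s'.
  by case: c eq_ins => //= j; apply: mulgI.
by apply: (@lift_inj _ ord_max); rewrite -!(lift_perm_lift ord_max) eq_fixed.
Qed.

(** Both sides have (n + 1)! elements. *)
Lemma insert_bij n :
  bijective (fun p : 'S_n * option 'I_n => insert p.1 p.2).
Proof.
apply: inj_card_bij (@insert_inj n) _.
by rewrite card_prod card_option !card_Sn card_ord factS mulnC.
Qed.

Lemma insert_surj n (t : 'S_n.+1) : exists s c, t = insert s c.
Proof. by have [f _ fK] := insert_bij n; exists (f t).1, (f t).2; rewrite fK. Qed.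

Lemma build_inj n : injective (@build n).
Proof.
elim: n => [|n IHn] /= => [[] []|] // [h c] [h' c'] /= eq_build.
have [/IHn -> /val_inj ->] // :=
  @insert_inj n (build h, val c) (build h', val c') eq_build.
Qed.

(** * Number of cycles after an insertion *)

Lemma porbit_insert_open n (s : 'S_n) :
  porbit (insert s None) ord_max = [set ord_max].
Proof.
have tX i : (insert s None ^+ i)%g ord_max = ord_max.
  by elim: i => [|i IHi]; rewrite ?expg0 ?perm1 // expgSr permM IHi insert_open.
apply/setP=> y; rewrite inE; apply/porbitP/eqP => [[i ->]|->]; first exact: tX.
by exists 0; rewrite expg0 perm1.
Qed.

(** The orbits of the extended permutation are those of [s], relabelled,
    together with the singleton of the new fixed point. *)
Lemma ncycles_insert_open n (s : 'S_n) :
  ncycles (insert s None) = (ncycles s).+1.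
Proof.
rewrite /ncycles; set t := insert s None.
have tX i x : (t ^+ i)%g (lift ord_max x) = lift ord_max ((s ^+ i)%g x).
  by elim: i => [|i IHi]; rewrite ?expg0 ?perm1 // !expgSr !permM IHi
     insert_open_old.
have orb_lift x : porbit t (lift ord_max x) = lift ord_max @: porbit s x.
  apply/setP=> y; apply/porbitP/imsetP => [[i ->]|[z /porbitP[i ->] ->]].
    by exists ((s ^+ i)%g x); rewrite ?mem_porbit.
  by exists i; rewrite tX.
have orb_max : porbit t ord_max = [set ord_max] := porbit_insert_open s.
have -> : porbits t =
    [set ord_max] |: [set lift ord_max @: (A : {set 'I_n}) | A in porbits s].
  apply/setP=> A; rewrite !inE; apply/imsetP/orP.
    case=> x _ ->; case: (unliftP ord_max x) => [y|] ->.
      by right; rewrite orb_lift; apply/imset_f/imset_f.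
    by left; rewrite orb_max.
  case=> [/eqP ->|/imsetP[_ /imsetP[x _ ->] ->]].
    by exists ord_max.
  by exists (lift ord_max x).
rewrite cardsU1 card_imset; last exact/imset_inj/lift_inj.
case: imsetP => // -[A _ /setP/(_ ord_max)]; rewrite set11 => /esym/imsetP[x _].
by move/eqP; rewrite (negPf (neq_lift _ _)).
Qed.

(** Insertion after [j] multiplies by a transposition that merges the new
    fixed point into the cycle of [j]. *)
Lemma ncycles_insert n (s : 'S_n) (c : option 'I_n) :
  ncycles (insert s c) = (c == None) + ncycles s.
Proof.
case: c => [j|]; last exact: ncycles_insert_open.
have open_max : lift ord_max j \notin porbit (insert s None) ord_max.
  by rewrite porbit_insert_open inE eq_sym neq_lift.
have := porbits_mul_tperm (insert s None) (lift ord_max j) ord_max.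
rewrite /= open_max eq_sym neq_lift /= -!/(ncycles _).
rewrite -[lift_perm _ _ s]/(insert s None).
by rewrite ncycles_insert_open addn2 addn1 => -[].
Qed.

(** * Restrictions after an insertion *)

(** Identifies the list [orbit f x] itself, starting point included, and not
    only up to rotation; this lets the list [orbit] be computed from a guess. *)
Lemma orbit_fcycle (T : finType) (f : T -> T) x p :
  fcycle f (x :: p) -> uniq (x :: p) -> orbit f x = x :: p.
Proof.
move=> fp Up; rewrite /orbit (order_cycle fp Up) ?mem_head //=.
have: fpath f x p by move: fp => /=; rewrite rcons_path => /andP[].
by move/fpathE=> def_p; rewrite -def_p.
Qed.

(** What an element of a cycle of [s] becomes in the cycle notation of
    [insert s c]. *)
Definition block n (c : option 'I_n) (x : 'I_n) : seq 'I_n.+1 :=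
  lift ord_max x :: (if c == Some x then [:: ord_max] else [::]).

Lemma insert_last_block n (s : 'S_n) c x :
  insert s c (last ord_max (block c x)) = lift ord_max (s x).
Proof.
rewrite /block; case: eqP => [->|/eqP neq_cx] /=; first exact: insert_after_new.
case: c neq_cx => [j|_]; last exact: insert_open_old.
by rewrite (inj_eq Some_inj) eq_sym => /insert_after_old ->.
Qed.

Lemma fpath_insert n (s : 'S_n) c x p : fpath s x p ->
  fpath (insert s c) (last ord_max (block c x)) (flatten (map (block c) p)).
Proof.
elim: p x => //= y p IHp x /andP[/eqP sx /IHp pth].
rewrite insert_last_block sx eqxx /=.
move: pth; rewrite {1}/block; case: eqP => [->|] //= pth.
by rewrite insert_after_pred eqxx.
Qed.

(** The last element of the concatenated blocks does not depend on the default
    [z], because the list of blocks is not empty. *)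
Lemma last_flatten_block n c (x : 'I_n) z p :
  last z (flatten (map (block c) (x :: p))) =
  last ord_max (block c (last x p)).
Proof.
elim: p x z => [|y p IHp] x z; first by rewrite /= cats0.
by rewrite [map _ _]/= [flatten _]/= -cat_cons last_cat IHp.
Qed.

Lemma uniq_flatten_block n (c : option 'I_n) p :
  uniq p -> uniq (flatten (map (block c) p)).
Proof.
have mem_old x q : (lift ord_max x \in flatten (map (block c) q)) = (x \in q).
  elim: q => //= y q IHq; rewrite !inE mem_cat IHq (inj_eq lift_inj).
  case: (c == _); rewrite ?inE //.
  by rewrite [_ == ord_max]eq_sym (negPf (neq_lift _ _)).
have mem_new q : ord_max \in flatten (map (block c) q) -> c \in map Some q.
  elim: q => //= y q IHq; rewrite !inE mem_cat (negPf (neq_lift _ _)) /=.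
  by case: eqP => //= _ /IHq.
elim: p => //= x p IHp /andP[xp /IHp Up].
rewrite mem_cat mem_old (negPf xp) orbF cat_uniq Up andbT.
case: eqP => [c_x|_] /=; last by apply/hasPn.
rewrite inE eq_sym neq_lift /=; apply/hasPn=> z z_in; rewrite inE.
apply: contra xp => /eqP z_max; rewrite -(mem_map Some_inj) -c_x.
by apply: mem_new; rewrite -z_max.
Qed.

(** The cycle of [insert s c] through an old element is the cycle of [s]
    through it, with n + 1 written after the place of insertion. *)
Lemma orbit_insert n (s : 'S_n) c x :
  orbit (insert s c) (lift ord_max x) = flatten (map (block c) (orbit s x)).
Proof.
have := cycle_orbit (@perm_inj _ s) x; have := orbit_uniq s x.
have -> : orbit s x = x :: behead (orbit s x).
  by rewrite /orbit -orderSpred.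
move: (behead _) => p Up; rewrite (cycle_path x) /= -/(last x p) => cyc.
(* Closing the cycle is a path from its last element back to its first one. *)
apply: orbit_fcycle; last exact: (uniq_flatten_block c Up).
rewrite -cat_cons -/(block c x) -[_ ++ _]/(flatten (map (block c) (x :: p))).
by rewrite (cycle_path ord_max) last_flatten_block; apply: fpath_insert.
Qed.

Lemma restriction_insert n e (s : 'S_n) c x : e <= n ->
  restriction e (insert s c) (lift ord_max x) = lift ord_max (restriction e s x).
Proof.
move=> le_en; rewrite /restriction orbit_insert.
rewrite -next_map ?filter_uniq ?orbit_uniq //; last exact: lift_inj.
congr next; elim: (orbit s x) => //= y p IHp.
rewrite filter_cat IHp /label lift_max.
by case: eqP => _ //=; case: ifP => //= _; rewrite ltnNge le_en.
Qed.

(** Nothing is deleted, so the cyclic successor is the image. *)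
Lemma restriction_full n (s : 'S_n) x : restriction n s x = s x.
Proof.
rewrite /restriction (_ : [seq y <- _ | _] = orbit s x); last first.
  by apply/all_filterP/allP=> y _; apply: ltn_ord.
have /next_cycle-/(_ x) := cycle_orbit (@perm_inj _ s) x.
by rewrite -fconnect_orbit connect0 => /(_ isT)/eqP.
Qed.

(** * Avoidance characterizes the permutations that are built *)

(** Here e is written as the label of [y]: a case analysis on [y] then separates
    the condition at the largest e from the conditions at the smaller ones. *)
Lemma avoidingP n (s : 'S_n) :
  reflect (forall x y : 'I_n, odd (label x) -> label y = (label x).+1 ->
             restriction (label y) s x != y)
          (avoiding s).
Proof.
apply: (iffP forallP) => [av x y odd_x def_y|av e].
  have lt_y : label y < n.+1 by rewrite ltnS; apply: ltn_ord.
  have even_y : (2 <= label y) && ~~ odd (label y).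
    by rewrite def_y ltnS oddS negbK odd_x.
  have /implyP/(_ even_y)/forallP/(_ x)/forallP/(_ y)/implyP :=
    av (Ordinal lt_y).
  by apply; rewrite /= [in X in X - 1]def_y subn1 !eqxx.
apply/implyP=> /andP[le2e even_e]; apply/forallP=> x; apply/forallP=> y.
apply/implyP=> /andP[/eqP def_x /eqP def_y]; rewrite -def_y; apply: av.
  by rewrite def_x oddB ?addbT // ltnW.
by rewrite def_x def_y subn1 prednK // ltnW.
Qed.

(** Conditions on an old [y] are those for [s]; the condition on the new largest
    element concerns the full permutation, whose value at the previous largest
    element is new exactly when insertion took place after it. *)
Lemma avoiding_insert n (s : 'S_n) c :
  avoiding (insert s c) = avoiding s && allowed c.
Proof.
have label_lift (x : 'I_n) : label (lift ord_max x) = label x.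
  by rewrite /label lift_max.
apply/avoidingP/andP=> [av|[/avoidingP av_s all_c] x y].
  split.
    apply/avoidingP=> x y odd_x def_y.
    have := av (lift ord_max x) (lift ord_max y).
    rewrite !label_lift => /(_ odd_x def_y).
    by rewrite restriction_insert ?ltn_ord // (inj_eq lift_inj).
  case: c av => // j av; apply/negP=> /andP[odd_n /eqP def_j].
  have := av (lift ord_max j) ord_max; rewrite label_lift def_j.
  move=> /(_ odd_n erefl); rewrite [label ord_max]/= restriction_full.
  by rewrite insert_eq_max eqxx.
case: (unliftP ord_max x) => [{}x|] ->; last first.
  move=> _ def_y; have := ltn_ord y.
  by rewrite -[_ < _]/(label y <= _) def_y ltnn.
rewrite label_lift; case: (unliftP ord_max y) => [{}y|] -> odd_x.
  rewrite label_lift => def_y.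
  by rewrite restriction_insert ?ltn_ord // (inj_eq lift_inj) av_s.
move=> [def_n]; rewrite [label ord_max]/= restriction_full insert_eq_max.
apply: contraL all_c => /eqP ->; rewrite negbK; apply/andP; split.
  by rewrite def_n.
exact/eqP.
Qed.

Lemma avoiding_build n :
  [set build h | h : history n] = [set s : 'S_n | avoiding s].
Proof.
apply/setP=> s; rewrite inE; apply/imsetP/idP => [[h _ ->]|].
  elim: n h {s} => [|n IHn] /= h; first by apply/avoidingP=> -[].
  by rewrite avoiding_insert IHn (valP h.2).
elim: n s => [|n IHn] s.
  by exists tt => //; apply/permP=> -[].
have [{}s [c ->]] := insert_surj s.
rewrite avoiding_insert => /andP[/IHn[h _ ->] all_c].
by exists (h, exist _ c all_c).
Qed.

(** * The recursion *)

(** All n insertions are allowed for even n, all but the last for odd n. *)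
Lemma sum_allowed n : \sum_(j : 'I_n) allowed (Some j) = 2 * n./2.
Proof.
case: n => [|m]; first by rewrite big_ord0.
rewrite big_ord_recr (eq_bigr (fun=> 1)) => [|j _]; last first.
  by rewrite /allowed /label /= eqSS (ltn_eqF (ltn_ord j)) andbF.
rewrite sum1_card card_ord /allowed /label /= eqxx andbT negbK.
rewrite uphalf_half mulnDr !mul2n -{1}(odd_double_half m).
by rewrite addnAC addnn.
Qed.

Lemma sum_option (T : finType) (F : option T -> nat) :
  \sum_c F c = F None + \sum_x F (Some x).
Proof.
rewrite (bigD1 None) //=; congr (_ + _).
rewrite (reindex_omap Some id) /= => [|[]] //.
by apply: eq_bigl => x; rewrite eqxx.
Qed.

(** Every permutation of [n + 1] is a unique insertion, so the count at n + 1 is a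
    sum over [s] and [c]; for fixed [s] the choice [None] contributes to the term
    c_2(n, k - 1) and the choices [Some j] to 2 * floor(n / 2) * c_2(n, k). *)
Lemma c2_avoiding n k :
  c2 n k = #|[set s : 'S_n | (ncycles s == k) && avoiding s]|.
Proof.
rewrite -sum1dep_card big_mkcond /=.
elim: n k => [|n IHn] k /=.
  have S0 (s : 'S_0) : s = 1%g by apply/permP=> -[].
  rewrite (bigD1 1%g) //= big1 ?addn0 => [|s]; last by rewrite (S0 s) eqxx.
  have -> : avoiding (1%g : 'S_0) by apply/avoidingP=> -[].
  rewrite /ncycles (_ : porbits _ = set0) ?cards0 ?andbT ?[0 == k]eq_sym.
    by case: eqP.
  by apply/setP=> A; rewrite inE; apply/imsetP=> -[[]].
rewrite (reindex _ (onW_bij _ (insert_bij n))) /=.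
rewrite -(pair_bigA _ (fun s c => if (ncycles (insert s c) == k) &&
                                     avoiding (insert s c) then 1 else 0)) /=.
under eq_bigr => s _.
  rewrite sum_option ncycles_insert avoiding_insert eqxx andbT addnC.
  under eq_bigr => j _.
    rewrite ncycles_insert avoiding_insert add0n andbA.
    rewrite (_ : (if _ then 1 else 0) =
       (if (ncycles s == k) && avoiding s then 1 else 0) * allowed (Some j));
      last by case: (_ && avoiding s); case: allowed.
    over.
  rewrite -big_distrr /= sum_allowed mulnC add1n.
  over.
rewrite big_split -big_distrr /= -IHn; congr (_ + _).
case: k => [|k]; last by rewrite IHn.
by rewrite big1.
Qed.

Theorem theorem6p7 (n k : nat) :
  [/\ injective (@build n),
      c2 n k = #|[set s in [set build h | h : history n] | ncycles s == k]|
    & c2 n k = #|[set s : 'S_n | (ncycles s == k) && avoiding s]|].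
Proof.
split; [exact: build_inj | | exact: c2_avoiding].
rewrite c2_avoiding avoiding_build; apply: eq_card => s.
by rewrite !inE andbC.
Qed.
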